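(* Let $s\in\mathbb{R}_{>0}^3$ and $m=n^2-1$. Then $$|\Delta_w|^{\frac1m}\,|P_n(s)|^{\frac1m}\le e+o_n(1),$$ where $o_n(1)$ denotes a quantity tending to $0$ as $n\to\infty$.
   Context: For an integer $n\ge2$ let $V(\mathbb{T}_n)=(\mathbb{Z}/n\mathbb{Z})^2$ be the vertex set of the discrete torus obtained from the triangular lattice $\mathbb{Z}+\mathbb{Z}\omega$, $\omega=e^{2\pi i/3}$, modulo $n$ (with $1\mapsto(1,0)$, $\omega\mapsto(0,1)$). For $f:V(\mathbb{T}_n)\to\mathbb{R}$ the discrete Hessian on the three families $E_0,E_1,E_2$ of unit rhombi is given by $D_0f(a,b)=f(a,b)+f(a+2,b+1)-f(a+1,b)-f(a+1,b+1)$, $D_1f(a,b)=f(a+1,b)+f(a,b+1)-f(a,b)-f(a+1,b+1)$, $D_2f(a,b)=f(a,b)+f(a+1,b+2)-f(a+1,b+1)-f(a,b+1)$. For $s=(s_0,s_1,s_2)\in\mathbb{R}_{>0}^3$, $P_n(s)$ is the bounded convex polytope of all $g:V(\mathbb{T}_n)\to\mathbb{R}$ with $\sum_v g(v)=0$ and $D_rg(v)\le s_r$ for all $v$ and $r\in\{0,1,2\}$; $|P_n(s)|$ is its $(n^2-1)$-dimensional Lebesgue measure in the hyperplane of mean-zero functions. Put $w_i^{(n)}=\frac1{n^2}\frac{\partial|P_n(s)|}{\partial s_i}$ for $i=0,1,2$. Let $\Delta_w$ be the function on $V(\mathbb{T}_n)$ whose convolution action on functions $f:V(\mathbb T_n)\to\mathbb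 R$ is, for $v=(v_1,v_2)$, $$2|P_n(s)|(\Delta_w*f)(v)=w_0^{(n)}\big(D_0f(v_1-1,v_2-1)+D_0f(v_1-1,v_2)\big)+w_1^{(n)}\big(D_1f(v_1,v_2)+D_1f(v_1-1,v_2-1)\big)+w_2^{(n)}\big(D_2f(v_1-1,v_2-1)+D_2f(v_1,v_2-1)\big).$$ The operator $f\mapsto\Delta_w*f$ is self-adjoint and preserves the space of mean-zero functions; $|\Delta_w|$ denotes the absolute value of the product of the eigenvalues of its restriction to the $m$-dimensional space of mean-zero functions. *)

(* Defs.v *)
From HB Require Import structures.
From mathcomp Require Import all_boot all_order all_algebra.
From mathcomp Require Import finmap.
From mathcomp Require Import all_classical all_reals all_analysis.
From mathcomp Require Import ring.
Set Implicit Arguments.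
Unset Strict Implicit.
Unset Printing Implicit Defensive.
Import Order.TTheory GRing.Theory Num.Theory.
Import numFieldNormedType.Exports.
Local Open Scope classical_set_scope.
Local Open Scope ring_scope.

(* Lebesgue measure on R^k: the iterated product measure, pushed forward to   *)
(* k-tuples.                                                                  *)
Fixpoint lebesgue_tuple (R : realType) (k : nat) :
    set (k.-tuple (measurableTypeR R)) -> \bar R :=
  match k with
  | 0 => \d_([tuple] : 0.-tuple (measurableTypeR R))
  | k'.+1 => pushforward (lebesgue_measure \x @lebesgue_tuple R k')%E
               (fun p : measurableTypeR R * k'.-tuple (measurableTypeR R) =>
                   [tuple of p.1 :: p.2])
  end.

Section sigma_finite_pack.
Context d (T : measurableType d) (R : realType).
Variables (mu : {measure set T -> \bar R}) (mu_sf : sigma_finite setT mu).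
Let nu : set T -> \bar R := mu.
HB.instance Definition _ := Measure.on nu.
HB.instance Definition _ := Measure_isSigmaFinite.Build _ _ _ nu mu_sf.

Lemma sigma_finite_measureP :
  exists nu : {sigma_finite_measure set T -> \bar R}, nu = mu :> (set T -> _).
Proof. by exists nu. Qed.

End sigma_finite_pack.

Lemma lebesgue_tuple_sigma_finite_measure (R : realType) (k : nat) :
  exists mu : {sigma_finite_measure set (k.-tuple (measurableTypeR R)) -> \bar R},
    mu = @lebesgue_tuple R k :> (set _ -> \bar R).
Proof.
set T := measurableTypeR R.
elim: k => [|k [mu muE]].
  by exists (\d_([tuple] : 0.-tuple T) : FiniteMeasure.type _ _).
pose cons_t (p : T * k.-tuple T) : k.+1.-tuple T := [tuple of p.1 :: p.2].
pose split_t (t : k.+1.-tuple T) : T * k.-tuple T :=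
  (thead t, [tuple of behead t]).
have mcons : measurable_fun [set: T * k.-tuple T] cons_t.
  by apply: measurable_cons; [exact: measurable_fst|exact: measurable_snd].
have msplit : measurable_fun [set: k.+1.-tuple T] split_t.
  apply/measurable_fun_pairP; split.
    exact: measurable_tnth.
  exact: measurable_behead.
have consK p : split_t (cons_t p) = p.
  by case: p => x t; congr pair; exact: val_inj.
pose nu : {measure set (T * k.-tuple T)%type -> \bar R} :=
  (@lebesgue_measure R \x mu)%E.
pose push_of := pushforward nu cons_t : {measure set (k.+1.-tuple T) -> \bar R}.
pose push := push_of mcons.
have sf : sigma_finite [set: k.+1.-tuple T] push.
  have /sigma_finiteP[F [FT Fnd Foo]] := sigma_finiteT (@lebesgue_measure R).
  have /sigma_finiteP[G [GT Gnd Goo]] := sigma_finiteT mu.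
  exists (fun i => split_t @^-1` (F i `*` G i)).
    apply/esym/seteqP; split => // t _.
    have: [set: T] (thead t) by [].
    have: [set: k.-tuple T] [tuple of behead t] by [].
    rewrite FT GT => -[i _ Gi] [j _ Fj]; exists (maxn i j) => //; split => /=.
      exact: (subsetPset _ _ (Fnd _ _ (leq_maxr i j))) Fj.
    exact: (subsetPset _ _ (Gnd _ _ (leq_maxl i j))) Gi.
  move=> i; have [mF Fi] := Foo i; have [mG Gi] := Goo i; split.
    rewrite -[X in measurable X]setTI; apply: msplit => //.
    exact: measurableX.
  rewrite /push /push_of /= /pushforward.
  have -> : cons_t @^-1` (split_t @^-1` (F i `*` G i)) = F i `*` G i.
    by apply/seteqP; split => p; rewrite /preimage /mkset consK.
  rewrite product_measure1E// lte_mul_pinfty//.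
  by rewrite ge0_fin_numE.
have [P PE] := sigma_finite_measureP sf.
by exists P; rewrite PE /= -muE.
Qed.

Lemma lebesgue_tuple_box (R : realType) (k : nat) (a b : 'I_k -> R) :
  (forall i, a i <= b i) ->
  lebesgue_tuple [set x : k.-tuple R | forall i, a i <= tnth x i <= b i]
  = (\prod_(i < k) (b i - a i))%:E.
Proof.
elim: k a b => [|k IH] a b ab.
  rewrite big_ord0 /= diracE mem_set// => i; by have := ltn_ord i.
rewrite big_ord_recl /= /pushforward.
have [mu muE] := lebesgue_tuple_sigma_finite_measure R k.
set B := [set x : k.-tuple R | forall i, a (lift ord0 i) <= tnth x i <= b (lift ord0 i)].
transitivity ((@lebesgue_measure R \x mu)%E (`[a ord0, b ord0]%classic `*` B)).
  rewrite muE; congr (product_measure1 _ _ _).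
  apply/seteqP; split => -[x t] /= => [h|[h1 h2] i].
    split; first by have := h ord0; rewrite in_itv.
    by move=> i; have := h (lift ord0 i); rewrite tnthS.
  have [j ->|->] := unliftP ord0 i; first by rewrite tnthS; exact: h2.
  by have := h1; rewrite in_itv.
have mB : measurable (B : set (k.-tuple (measurableTypeR R))).
  rewrite (_ : B = \bigcap_(i in [set: 'I_k])
     ((@tnth k (measurableTypeR R))^~ i @^-1` `[a (lift ord0 i), b (lift ord0 i)]%classic)).
    apply: (@fin_bigcap_measurable _ (k.-tuple (measurableTypeR R)) 'I_k) =>
      [|i _]; first exact: finite_finset.
    rewrite -[X in measurable X]setTI.
    apply: (@measurable_tnth _ (measurableTypeR R)) => //.
  apply/seteqP; split => x /= h i; first by move=> _; rewrite /= in_itv /= h.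
  by have := h i I; rewrite /= in_itv.
rewrite product_measure1E//.
rewrite EFinM /= (lebesgue_measure_itv `[a ord0, b ord0]) muE.
rewrite [X in (_ * X)%E]IH// /= lte_fin.
have := ab ord0; rewrite le_eqVlt => /predU1P[->|->//].
by rewrite ltxx subrr mul0e.
Qed.

(* Faithful to (Z/nZ)^2 only for n >= 2, since 'Z_0 and 'Z_1 are Z/2Z.        *)
Notation torus n := ('Z_n * 'Z_n)%type.

Section Torus.
Variables (R : realType) (n : nat).
Implicit Types (s w : 'rV[R]_3) (v u : torus n).

Section Hessian.
Variable f : torus n -> R.

Definition D0 v : R := let: (a, b) := v in
  f (a, b) + f (a + 2, b + 1) - f (a + 1, b) - f (a + 1, b + 1).

Definition D1 v : R := let: (a, b) := v in
  f (a + 1, b) + f (a, b + 1) - f (a, b) - f (a + 1, b + 1).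

Definition D2 v : R := let: (a, b) := v in
  f (a, b) + f (a + 1, b + 2) - f (a + 1, b + 1) - f (a, b + 1).

Definition hess (r : 'I_3) v : R :=
  match val r with 0 => D0 v | 1 => D1 v | _ => D2 v end.

Definition hess_op w v : R := let: (a, b) := v in
    w 0 0 * (D0 (a - 1, b - 1) + D0 (a - 1, b))
  + w 0 1 * (D1 (a, b) + D1 (a - 1, b - 1))
  + w 0 2 * (D2 (a - 1, b - 1) + D2 (a, b - 1)).

End Hessian.

Definition hess_polytope s : set (torus n -> R) :=
  [set g | \sum_v g v = 0 /\ forall v r, hess g r v <= s 0 r].

(* A linear isometry of R^(n^2 - 1) onto the hyperplane of mean-zero          *)
(* functions: the restriction to {x | x_0 = 0} of the reflection exchanging   *)
(* the indicator of the vertex of rank 0 and the unit normal 1/n.  See        *)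
(* sum_meanzero_coord and meanzero_coord_isometry.                            *)
Definition meanzero_coord (x : (n ^ 2 - 1).-tuple R) v : R :=
  let S := \sum_(t <- x) t in
  if val (enum_rank v) is i.+1 then x`_i - S / (n%:R * (n%:R - 1))
  else S / n%:R.

Definition vol s : R :=
  fine (lebesgue_tuple [set x | hess_polytope s (meanzero_coord x)]).

Definition weights s : 'rV[R]_3 :=
  \row_i ((n ^ 2)%:R^-1 * 'D_(delta_mx 0 i) vol s).

Definition convol (K f : {ffun torus n -> R^o}) : {ffun torus n -> R^o} :=
  [ffun v : torus n => \sum_(u : torus n) K (v - u) * f u].

Definition origin_mass : {ffun torus n -> R^o} := [ffun v : torus n => (v == 0)%:R].

(* The kernel of the convolution operator is its value at the Dirac mass at   *)
(* 0; see convol_Delta_w.                                                     *)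
Definition Delta_w s : {ffun torus n -> R^o} :=
  [ffun v => hess_op origin_mass (weights s) v / (2 * vol s)].

Definition meanzero : {vspace {ffun torus n -> R^o}} :=
  lker (linfun (fun f : {ffun torus n -> R^o} => \sum_(v : torus n) f v : R^o)).

(* The operator K * _ compressed to meanzero; convolutions preserve meanzero, *)
(* so this is a genuine restriction, see convol_meanzero and                  *)
(* convol_meanzero_opE.                                                       *)
Definition convol_meanzero_op (K : {ffun torus n -> R^o}) :
    'End(subvs_of meanzero) :=
  linfun (vsproj meanzero \o convol K \o vsval).

End Torus.

(* Product of the eigenvalues counted with multiplicity.  Multiplicities are  *)
(* dimensions of eigenspaces, so this is meant for diagonalizable (here:      *)
(* self-adjoint) endomorphisms.  The iterated product over a classical set    *)
(* ranges over all of it because the set is finite, see finite_leigenvalue.   *)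
Definition eigenvalue_prod (R : realType) (V : vectType R) (L : 'End(V)) : R :=
  \big[*%R/1]_(a \in [set a | passmx.leigenvalue L a])
    a ^+ \dim (passmx.leigenspace L a).

Definition absdet_Delta_w (R : realType) (n : nat) (s : 'rV[R]_3) : R :=
  `|eigenvalue_prod (convol_meanzero_op (Delta_w n s))|.

Lemma sum_torus_rank (R : realType) (n : nat) (F : nat -> R) : (2 <= n)%N ->
  \sum_(v : torus n) F (enum_rank v) = F 0%N + \sum_(i < n ^ 2 - 1) F i.+1.
Proof.
move=> n2.
have cardT : #|{: torus n}| = (n ^ 2 - 1).+1.
  by rewrite card_prod card_ord Zp_cast// mulnn subn1 prednK// expn_gt0 (ltnW n2).
rewrite (reindex (@enum_val _ (mem {: torus n}))) /=; last first.
  by apply: onW_bij; exact: enum_val_bij.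
under eq_bigr do rewrite enum_valK.
rewrite -(big_mkord xpredT (fun i => F i)) cardT big_nat_recl//.
by rewrite big_mkord.
Qed.

Section coord.
Variables (R : realType) (n : nat) (n2 : (2 <= n)%N) (x : (n ^ 2 - 1).-tuple R).

Lemma sum_meanzero_coord : \sum_v meanzero_coord x v = 0.
Proof.
have n0 : n%:R != 0 :> R by rewrite pnatr_eq0 -lt0n (ltnW n2).
have n1 : n%:R - 1 != 0 :> R by rewrite subr_eq0 pnatr_eq1 neq_ltn n2 orbT.
rewrite /meanzero_coord; set S := \sum_(t <- x) t.
rewrite (sum_torus_rank (fun k => if k is i.+1
  then x`_i - S / (n%:R * (n%:R - 1)) else S / n%:R))//.
have SE : \sum_(i < n ^ 2 - 1) x`_i = S.
  by rewrite /S (big_nth 0) big_mkord size_tuple.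
rewrite sumrB SE sumr_const card_ord -[_ *+ (_ - 1)]mulr_natr natrB ?expn_gt0 ?(ltnW n2)//.
rewrite natrX; field; exact/andP.
Qed.

Lemma meanzero_coord_isometry :
  \sum_v meanzero_coord x v ^+ 2 = \sum_(t <- x) t ^+ 2.
Proof.
have n0 : n%:R != 0 :> R by rewrite pnatr_eq0 -lt0n (ltnW n2).
have n1 : n%:R - 1 != 0 :> R by rewrite subr_eq0 pnatr_eq1 neq_ltn n2 orbT.
rewrite /meanzero_coord; set S := \sum_(t <- x) t.
rewrite (sum_torus_rank (fun k => (if k is i.+1
  then x`_i - S / (n%:R * (n%:R - 1)) else S / n%:R) ^+ 2))//.
have SE : \sum_(i < n ^ 2 - 1) x`_i = S.
  by rewrite /S (big_nth 0) big_mkord size_tuple.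
set c := S / (n%:R * (n%:R - 1)).
under eq_bigr do rewrite sqrrB.
rewrite big_split sumrB /= sumrMnl -mulr_suml SE sumr_const card_ord.
rewrite [in RHS](big_nth 0) big_mkord size_tuple -[_ *+ (_ - 1)]mulr_natr.
rewrite natrB ?expn_gt0 ?(ltnW n2)// natrX /c.
set Q := \sum_(i < _) _; field; exact/andP.
Qed.
End coord.

Lemma hess_op_sum (R : realType) (n : nat) (w : 'rV[R]_3)
    (f : torus n -> R) (g : torus n -> torus n -> R) v :
  hess_op (fun v => \sum_u g u v * f u) w v = \sum_u hess_op (g u) w v * f u.
Proof.
case: v => a b; rewrite /hess_op /D0 /D1 /D2.
rewrite -!(sumrN, big_split) /= !mulr_sumr -!big_split /=.
by apply: eq_bigr => u _; ring.
Qed.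

Lemma hess_op_shift (R : realType) (n : nat) (w : 'rV[R]_3)
    (g : torus n -> R) u v :
  hess_op (fun v => g (v - u)) w v = hess_op g w (v - u).
Proof.
case: u v => [c d] [a b]; rewrite /hess_op /D0 /D1 /D2 /=.
have E (p q : 'Z_n) : (p, q) - (c, d) = (p - c, q - d) :> torus n by [].
by rewrite !E !(addrAC _ _ (- c)) !(addrAC _ _ (- d)).
Qed.

Lemma convol_Delta_w (R : realType) (n : nat) (s : 'rV[R]_3) f (v : torus n) :
  vol n s != 0 ->
  2 * vol n s * convol (Delta_w n s) f v = hess_op f (weights n s) v.
Proof.
move=> vol0; rewrite ffunE mulr_sumr.
have -> : hess_op f (weights n s) v =
    hess_op (fun v : torus n => \sum_(u : torus n) origin_mass R n (v - u) * f u) (weights n s) v.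
  congr (hess_op _ _ _); apply/funext => t.
  rewrite (bigD1 t)//= big1 ?addr0 => [|u ut].
    by rewrite ffunE subrr eqxx mul1r.
  by rewrite ffunE subr_eq0 eq_sym (negPf ut) mul0r.
rewrite (hess_op_sum _ _ (fun u v : torus n => origin_mass R n (v - u))).
apply: eq_bigr => u _; rewrite hess_op_shift ffunE.
by field.
Qed.

Section linear.
Variables (R : realType) (n : nat) (K : {ffun torus n -> R^o}).

Let total (f : {ffun torus n -> R^o}) : R^o := \sum_v f v.

Let total_linear : linear total.
Proof.
move=> a f g; rewrite /total scaler_sumr -big_split /=.
by apply: eq_bigr => v _; rewrite !ffunE.
Qed.

Lemma meanzeroE (f : {ffun torus n -> R^o}) :
  (f \in meanzero R n) = (\sum_v f v == 0).
Proof.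
pose L : {linear _ -> _} :=
  HB.pack total (GRing.isLinear.Build _ _ _ _ total total_linear).
by rewrite memv_ker (lfunE L).
Qed.

Lemma convol_is_linear : linear (convol K).
Proof.
move=> a f g; apply/ffunP => v; rewrite !ffunE scaler_sumr -big_split /=.
by apply: eq_bigr => u _; rewrite !ffunE mulrDr; congr (_ + _); exact: mulrCA.
Qed.
HB.instance Definition _ := GRing.isLinear.Build _ _ _ _ (convol K) convol_is_linear.

End linear.

Lemma convol_meanzero (R : realType) (n : nat) (K f : {ffun torus n -> R^o}) :
  f \in meanzero R n -> convol K f \in meanzero R n.
Proof.
rewrite !meanzeroE => /eqP f0; apply/eqP.
under eq_bigr do rewrite ffunE.
rewrite exchange_big /=.
under eq_bigr => u _.
  rewrite -mulr_suml (reindex_inj (addIr u)) /=.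
  under eq_bigr do rewrite addrK.
  over.
by rewrite -mulr_sumr f0 mulr0.
Qed.

Lemma convol_meanzero_opE (R : realType) (n : nat) (K : {ffun torus n -> R^o})
    (f : subvs_of (meanzero R n)) :
  vsval (convol_meanzero_op K f) = convol K (vsval f).
Proof.
rewrite /convol_meanzero_op lfunE /=.
by rewrite vsprojK// convol_meanzero// subvsP.
Qed.

Lemma finite_leigenvalue (R : realType) (V : vectType R) (L : 'End(V)) :
  finite_set [set a | passmx.leigenvalue L a].
Proof.
set M := passmx.mxof (vbasis {:V}) (vbasis {:V}) L.
have p0 : char_poly M != 0 by rewrite monic_neq0// char_poly_monic.
apply: contrapT => /(@infinite_set_fset _ _ (size (char_poly M)))[B BA].
have Bb := vbasisP {:V}.
have rB : all (root (char_poly M)) B.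
  apply/allP => a aB; rewrite -eigenvalue_root_char /eigenvalue.
  have /= := BA _ aB.
  rewrite /passmx.leigenvalue (passmx.leigenspaceE Bb).
  by rewrite passmx.vsof_eq0.
by move=> le; have := max_poly_roots p0 rB (fset_uniq B); rewrite ltnNge le.
Qed.

(* Main.v *)
Require Import Defs.
From HB Require Import structures.
From mathcomp Require Import all_boot all_order all_algebra.
From mathcomp Require Import all_classical all_reals all_analysis.
From mathcomp Require Import measurable_realfun ring lra.
From mathcomp Require complex.
Set Implicit Arguments.
Unset Strict Implicit.
Unset Printing Implicit Defensive.
Import Order.TTheory GRing.Theory Num.Theory.
Import numFieldNormedType.Exports.
Local Open Scope classical_set_scope.
Local Open Scope ring_scope.

(** Write P for the polytope P_n(s), N = n^2, m = N - 1.  The operator given by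
    Delta_w maps P into a simplex whose volume is known, and comparing volumes
    gives the bound.

    On the one hand, the weights are nonnegative, because the volume increases
    with s, and the sum of the s_r w_r is at most (m / N) |P|
    (weights_ge0_sum_le).  This is one half of the Euler identity for the
    function s |-> |P_n(s)|, which is homogeneous of degree m, and this half has
    an elementary proof: for h > 0, relaxing s_r to (1 + h) s_r for a single r
    adds to P a set of functions violating only constraints of the family r.
    The three sets are therefore disjoint, and all lie in P_n((1 + h) s) minus
    P, whose volume is ((1 + h)^m - 1) |P| (sum_vol_increments).  Dividing by h
    and letting h tend to 0 gives the claim.  Since D_r f <= s_r on P, and every
    D_r occurs twice in the Hessian operator, each value of the convolution
    of Delta_w with some f in P is at most m / N (convol_Delta_le).

    On the other hand, mean-zero functions with values at most m / N form a
    simplex: in the coordinates y_j = m / N - (value at the j-th vertex), where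
    one vertex is left out, it is the set of y >= 0 with sum at most m, and that
    set has volume at most e^m (row_volume_simplex).  The map from the isometric
    coordinates on mean-zero functions to the coordinates y has determinant
    |Delta_w| / n in absolute value: the operator itself contributes the product
    of its eigenvalues, as it is symmetric (eigenvalue_prod_convol), and leaving
    out a vertex contributes 1 / n (det_tilt).  The change of variables formula
    (row_volume_affine) then yields |Delta_w| |P| <= n e^m.  Taking m-th roots,
    n^(1/m) <= exp(1 / (n + 1)), which tends to 1. *)

(** * Affine changes of variable on the line *)

Section one_dim.
Context {R : realType}.
Notation leb := (@lebesgue_measure R).
Notation T := (measurableTypeR R).

Lemma measurable_affine (a b : R) : measurable_fun setT (fun x : T => a * x + b : T).
Proof. by apply: measurable_funD => //; apply: measurable_funM. Qed.

Lemma affine_preimage_itv (a b c d : R) : a != 0 ->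
  leb ((fun x : T => a * x + b : T) @^-1` `]c, d]) = (`|a|^-1%:E * leb `]c, d])%E.
Proof.
move=> a0.
have [agt|alt|] := ltgtP 0 a; last by move=> a0'; rewrite -a0' eqxx in a0.
- rewrite (_ : _ @^-1` _ = `](c - b) / a, (d - b) / a]%classic); last first.
    by apply/seteqP; split => x /=; rewrite !in_itv /= ltr_pdivrMr// ler_pdivlMr//
      (mulrC x) ltrBlDr lerBrDr.
  rewrite !lebesgue_measure_itv /= !lte_fin gtr0_norm// ltr_pM2r ?invr_gt0// ltrD2r.
  case: ifP => _; rewrite ?mule0// -!EFinD -EFinM; congr EFin; ring.
- rewrite (_ : _ @^-1` _ = `[(d - b) / a, (c - b) / a[%classic); last first.
    by apply/seteqP; split => x /=; rewrite !in_itv /= ler_ndivrMr// ltr_ndivlMr//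
      (mulrC x) ltrBlDr lerBrDr andbC.
  rewrite !lebesgue_measure_itv /= !lte_fin ltr0_norm// ltr_nM2r ?invr_lt0// ltrD2r.
  case: ifP => _; rewrite ?mule0// -!EFinD -EFinM; congr EFin.
  rewrite invrN; ring.
Qed.

Lemma lebesgue_measure_affine (a b : R) (A : set T) : a != 0 -> measurable A ->
  leb ((fun x : T => a * x + b : T) @^-1` A) = (`|a|^-1%:E * leb A)%E.
Proof.
move=> a0 mA.
pose p0 := pushforward leb (fun x : T => a * x + b : T) : {measure set T -> \bar R}.
pose p := p0 (measurable_affine a b).
have na : 0 <= `|a| by [].
pose q : {measure set T -> \bar R} := mscale (NngNum na) p.
have -> : leb A = q A.
  apply: lebesgue_measure_unique => // _ [[c d]] _ <-.
  transitivity (`|a|%:E * (`|a|^-1%:E * leb `]c, d]))%E.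
    by rewrite muleA -EFinM divff ?normr_eq0// mul1e.
  by congr (_ * _)%E; rewrite -(affine_preimage_itv b).
transitivity (`|a|^-1%:E * (`|a|%:E * p A))%E => //.
by rewrite muleA -EFinM mulVf ?normr_eq0// mul1e.
Qed.

Lemma integral_affine (a b : R) (G : T -> \bar R) : a != 0 ->
  measurable_fun setT G -> (forall x, 0 <= G x)%E ->
  (\int[leb]_x G (a * x + b)%R = `|a|^-1%:E * \int[leb]_x G x)%E.
Proof.
move=> a0 mG G0.
have na : 0 <= `|a|^-1 by rewrite invr_ge0.
have := @ge0_integral_pushforward _ _ _ _ R _ (measurable_affine a b) leb setT G
  measurableT mG (fun x _ => G0 x).
rewrite preimage_setT /comp => <-.
transitivity (\int[mscale (NngNum na) leb]_x G x)%E;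
  last by rewrite ge0_integral_mscale.
apply: eq_measure_integral => [|mf A mA _]; first exact: measurable_affine.
exact: (lebesgue_measure_affine b a0 mA).
Qed.

End one_dim.

(** * Linear changes of variables for Lebesgue measure on tuples *)

Section coordinates.
Context {R : realType}.
Notation leb := (@lebesgue_measure R).
Notation T := (measurableTypeR R).

(** The set function lebesgue_tuple, bundled with the measure structure that
    Fubini and additivity ask for. *)
Definition lebesgue_tuple_measure k :
    {sigma_finite_measure set (k.-tuple T) -> \bar R} :=
  sval (cid (lebesgue_tuple_sigma_finite_measure R k)).

Lemma lebesgue_tuple_measureE k : lebesgue_tuple_measure k =
  @lebesgue_tuple R k :> (set _ -> _).
Proof. exact: (svalP (cid (lebesgue_tuple_sigma_finite_measure R k))). Qed.

Definition row_of_tuple k (t : k.-tuple T) : 'rV[R]_k := \row_i tnth t i.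

(** Row vectors carry no sigma-algebra; measurability and volume are transported
    from tuples, so that linear maps can be written as matrices. *)
Definition row_measurable k (S : set 'rV[R]_k) := measurable (@row_of_tuple k @^-1` S).

Definition row_volume k (S : set 'rV[R]_k) : \bar R :=
  lebesgue_tuple_measure k (@row_of_tuple k @^-1` S).

Definition slice k (S : set 'rV[R]_(1 + k)) (x : R) : set 'rV[R]_k :=
  [set v | S (row_mx x%:M v)].

Definition coslice k (S : set 'rV[R]_(1 + k)) (v : 'rV[R]_k) : set R :=
  [set x | S (row_mx x%:M v)].

Lemma row_of_tuple_cons k x (t : k.-tuple T) :
  @row_of_tuple k.+1 [tuple of x :: t] = row_mx x%:M (row_of_tuple t).
Proof.
apply/rowP => i; rewrite !mxE; case: splitP => j ij.
  rewrite (_ : i = ord0) ?tnth0 ?mxE; last by apply/val_inj; rewrite /= ij ord1.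
  by rewrite ord1 eqxx mulr1n.
rewrite mxE (_ : i = lift ord0 j) ?tnthS//; exact/val_inj.
Qed.

Section slices.
Context k (S : set 'rV[R]_(1 + k)) (mS : @row_measurable k.+1 S).

Let cons_t (p : T * k.-tuple T) : k.+1.-tuple T := [tuple of p.1 :: p.2].

Let mcons : measurable (cons_t @^-1` (@row_of_tuple k.+1 @^-1` S)).
Proof.
rewrite -[X in measurable X]setTI.
suff : measurable_fun [set: T * k.-tuple T] cons_t by move=> /(_ measurableT); exact.
by apply: measurable_cons; [exact: measurable_fst|exact: measurable_snd].
Qed.

Let xsectionE x : xsection (cons_t @^-1` (@row_of_tuple k.+1 @^-1` S)) x =
  @row_of_tuple k @^-1` slice S x.
Proof.
by apply/seteqP; split => t;
  rewrite /xsection /= ?inE /slice /preimage /= row_of_tuple_cons.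
Qed.

Let ysectionE t : ysection (cons_t @^-1` (@row_of_tuple k.+1 @^-1` S)) t =
  coslice S (row_of_tuple t).
Proof.
by apply/seteqP; split => x;
  rewrite /ysection /= ?inE /coslice /preimage /= row_of_tuple_cons.
Qed.

Lemma row_measurable_slice x : row_measurable (slice S x).
Proof. by rewrite /row_measurable -xsectionE; exact: measurable_xsection. Qed.

Lemma measurable_coslice t : measurable (coslice S (@row_of_tuple k t) : set T).
Proof. by rewrite -ysectionE; exact: measurable_ysection. Qed.

(** Slices integrate over the first coordinate last, coslices integrate over it
    first; the former suit maps acting on the first coordinate on its own, the
    latter suit shears that move only the first coordinate. *)
Lemma row_volume_slice : row_volume (k := k.+1) S =
  (\int[leb]_x row_volume (slice S x))%E.
Proof.
rewrite /row_volume lebesgue_tuple_measureE /= -lebesgue_tuple_measureE /pushforward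
  /product_measure1.
by apply: eq_integral => x _ /=; rewrite -xsectionE.
Qed.

Lemma measurable_row_volume_slice : measurable_fun setT (fun x : T =>
  row_volume (slice S x)).
Proof.
have := measurable_fun_xsection (lebesgue_tuple_measure k) mcons.
by rewrite (_ : _ \o _ = fun x : T => row_volume (slice S x))//;
  apply/funext => x /=; rewrite xsectionE.
Qed.

Lemma row_volume_coslice : row_volume (k := k.+1) S =
  (\int[lebesgue_tuple_measure k]_t leb (coslice S (row_of_tuple t)))%E.
Proof.
have := indic_fubini_tonelli leb (lebesgue_tuple_measure k) mcons.
rewrite indic_fubini_tonelli_FE// indic_fubini_tonelli_GE//.
rewrite row_volume_slice => E.
transitivity (\int[leb]_x (lebesgue_tuple_measure k \o xsection (cons_t @^-1`
  (@row_of_tuple k.+1 @^-1` S))) x)%E.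
  by apply: eq_integral => x _ /=; rewrite xsectionE.
by rewrite E; apply: eq_integral => x _ /=; rewrite ysectionE.
Qed.

End slices.

Lemma row_measurable_lin k l (S : set 'rV[R]_l) (B : 'M[R]_(k, l)) (b : 'rV_l) :
  row_measurable S -> row_measurable [set v | S (v *m B + b)].
Proof.
move=> mS; rewrite /row_measurable.
pose f (t : k.-tuple T) : l.-tuple T := [tuple (row_of_tuple t *m B + b) 0 i | i < l].
have fE t : row_of_tuple (f t) = row_of_tuple t *m B + b.
  by apply/rowP => i; rewrite mxE tnth_mktuple.
rewrite (_ : _ @^-1` _ = f @^-1` (@row_of_tuple l @^-1` S)); last first.
  by apply/seteqP; split => t; rewrite /preimage /= fE.
rewrite -[X in measurable X]setTI.
suff mf : measurable_fun setT f by exact: mf.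
apply/measurable_fun_tnthP => i; rewrite (_ : _ \o _ =
   (fun t => \sum_j tnth t j * B j i + b 0 i)); last first.
  by apply/funext => t /=; rewrite tnth_mktuple !mxE; congr (_ + _);
    apply: eq_bigr => j _; rewrite mxE.
apply: measurable_funD => //; apply: measurable_sum => j.
by apply: measurable_funM => //; exact: measurable_tnth.
Qed.

Lemma row_measurable_mul k l (S : set 'rV[R]_l) (B : 'M[R]_(k, l)) :
  row_measurable S -> row_measurable [set v | S (v *m B)].
Proof.
by move=> /(row_measurable_lin B 0); under eq_set do rewrite addr0.
Qed.

Lemma row_measurable_translate k (S : set 'rV[R]_k) (b : 'rV[R]_k) :
  row_measurable S -> row_measurable [set v | S (v + b)].
Proof.
by move=> /(row_measurable_lin 1%:M b); under eq_set do rewrite mulmx1.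
Qed.

(** Induction on the dimension: a translation acts on slices by a translation,
    and permutes the slices by a translation of the line. *)
Lemma row_volume_translate k (S : set 'rV[R]_k) (b : 'rV[R]_k) :
  row_measurable S -> row_volume [set v | S (v + b)] = row_volume S.
Proof.
elim: k S b => [|k IH] S b mS.
  by congr row_volume; apply/seteqP; split => v /=;
    rewrite (thinmx0 v) (thinmx0 b) addr0.
suff H (S1 : set 'rV[R]_(1 + k)) b1 : row_measurable S1 ->
  row_volume [set v | S1 (v + b1)] = row_volume S1.
  exact: (H S b mS).
move: S1 b1 => {mS b}S b mS.
set b0 := lsubmx b 0 0; set b' := rsubmx b.
have bE : b = row_mx b0%:M b' by rewrite -mx11_scalar hsubmxK.
have sE x : slice [set v | S (v + b)] x = [set v | slice S (x + b0) (v + b')].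
  by apply/seteqP; split => v; rewrite /slice /= bE add_row_mx -raddfD.
rewrite row_volume_slice.
rewrite [RHS]row_volume_slice.
transitivity (\int[leb]_x row_volume (slice S (1 * x + b0)%R))%E.
  by apply: eq_integral => x _; rewrite mul1r sE IH//; exact: row_measurable_slice.
rewrite (integral_affine (G := fun x => row_volume (slice S x)) b0 (oner_neq0 _)).
- by rewrite normr1 invr1 mul1e.
- exact: measurable_row_volume_slice.
- by move=> x; exact: measure_ge0.
Qed.

Definition rescales k (B : 'M[R]_k) := forall S, row_measurable S ->
  row_volume [set v | S (v *m B)] = (`|\det B|^-1%:E * row_volume S)%E.

Lemma rescalesM k (A B : 'M[R]_k) : rescales A -> rescales B -> rescales (A *m B).
Proof.
move=> hA hB S mS.
under eq_set do rewrite mulmxA.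
rewrite (hA [set v | S (v *m B)]); last exact: row_measurable_mul.
by rewrite hB// muleA -EFinM det_mulmx normrM invfM.
Qed.

(** The slice over x of the preimage of S is the preimage under B of a translate
    of the slice of S over a x, so slicewise the factor is that of B, and the
    substitution x |-> a x supplies the factor of a. *)
Lemma rescales_ublock k (a : R) (u : 'rV[R]_k) (B : 'M[R]_k) :
  a != 0 -> rescales B -> rescales (block_mx a%:M u 0 B : 'M[R]_(1 + k)).
Proof.
move=> a0 hB.
have dE : \det (block_mx a%:M u 0 B : 'M[R]_(1 + k)) = a * \det B.
  by rewrite det_ublock det_scalar1.
move=> S mS.
rewrite row_volume_slice.
have sE x : slice [set v | S (v *m block_mx a%:M u 0 B)] x =
            [set v | [set w | slice S (a * x + 0) (w + x *: u)] (v *m B)].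
  apply/seteqP; split => v; rewrite /slice /= mul_row_block mulmx0 !addr0
   -scalar_mxM mulrC mul_scalar_mx addrC //.
transitivity (\int[leb]_x (`|\det B|^-1%:E * row_volume (slice S (a * x + 0)%R)))%E.
  apply: eq_integral => x _; rewrite sE hB; last first.
    exact: (row_measurable_translate (x *: u) (row_measurable_slice mS (a * x + 0))).
  by rewrite row_volume_translate//; exact: (row_measurable_slice mS).
have mG := measurable_row_volume_slice mS.
rewrite (integral_affine (G := fun x =>
  (`|\det B|^-1%:E * row_volume (slice S x))%E) 0 a0).
- rewrite ge0_integralZl//.
  by rewrite muleA -EFinM -row_volume_slice dE normrM invfM.
- exact: measurable_funeM.
- by move=> x; rewrite mule_ge0 ?measure_ge0// lee_fin invr_ge0.
Qed.

(** This shear translates each line parallel to the first axis along itself. *)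
Lemma rescales_lower k (v : 'cV[R]_k) : rescales (block_mx 1 0 v 1%:M : 'M[R]_(1 + k)).
Proof.
have dE : \det (block_mx 1 0 v 1%:M : 'M[R]_(1 + k)) = 1.
  by rewrite det_lblock !det1 mulr1.
move=> S mS; rewrite dE normr1 invr1 mul1e.
rewrite row_volume_coslice; last exact: row_measurable_mul.
rewrite row_volume_coslice//; apply: eq_integral => t _.
rewrite -[RHS]mul1e -[X in (X%:E * _)%E]invr1 -[X in X^-1]normr1.
rewrite -(lebesgue_measure_affine ((row_of_tuple t *m v) 0 0) (oner_neq0 R));
  last exact: measurable_coslice.
congr (leb _); apply/seteqP; split => x;
  rewrite /coslice /preimage /= mul_row_block mulmx0 add0r !mulmx1
  mul1r raddfD /= -mx11_scalar//.
Qed.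

(** Gaussian elimination, as an induction on the dimension.  If the corner entry
    is nonzero, the Schur complement factors the matrix into a lower shear and a
    block upper triangular matrix.  Otherwise some entry below the corner is
    nonzero, and adding that row to the first one reduces to the first case. *)
Lemma rescales_unit k (B : 'M[R]_k) : \det B != 0 -> rescales B.
Proof.
elim: k B => [|k IH] B dB.
  move=> S mS; rewrite det_mx00 normr1 invr1 mul1e.
  by congr row_volume; apply/seteqP; split => v /=; rewrite (thinmx0 v) mul0mx.
have corner (C : 'M[R]_(1 + k)) : \det C != 0 -> C 0 0 != 0 -> rescales C.
  move=> dC a0; set a := C 0 0 in a0.
  set u := ursubmx C; set v := dlsubmx C; set D := drsubmx C.
  have aE : ulsubmx C = a%:M.
    by rewrite [LHS]mx11_scalar !mxE /a; congr (C _ _)%:M; apply/val_inj.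
  have CE : C = block_mx 1 0 (a^-1 *: v) 1%:M *m block_mx a%:M u 0 (D - a^-1 *: v *m u).
    rewrite mulmx_block !mul1mx !mul0mx !addr0 mul_mx_scalar scalerA divff// scale1r.
    by rewrite addrC subrK -aE submxK.
  have dCE : \det C = a * \det (D - a^-1 *: v *m u).
    by rewrite {1}CE det_mulmx det_lblock det_ublock !det1 !mul1r det_scalar1.
  rewrite CE; apply: rescalesM; first exact: rescales_lower.
  apply: rescales_ublock => //; apply: IH.
  by apply: contraNneq dC => E; rewrite dCE E mulr0.
suff main (C : 'M[R]_(1 + k)) : \det C != 0 -> rescales C by exact: (main B dB).
move=> {B dB} dC.
have [C0|] := boolP (C 0 0 == 0); last exact: corner.
have [i Ci] : exists i : 'I_k, dlsubmx C i 0 != 0.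
  apply/existsP; rewrite -negb_forall; apply: contra dC => /forallP Cz.
  rewrite -(submxK C) (_ : ulsubmx C = 0); last first.
    rewrite [LHS]mx11_scalar !mxE (_ : lshift k 0 = 0); last exact/val_inj.
    by rewrite (eqP C0) raddf0.
  rewrite (_ : dlsubmx C = 0); last by apply/colP => j; rewrite (eqP (Cz j)) mxE.
  by rewrite det_ublock det0 ?mul0r.
(* U 1 adds row i of the lower block to the first row; U (-1) undoes it. *)
pose e := delta_mx 0 i : 'rV[R]_k.
pose U (c : R) : 'M[R]_(1 + k) := block_mx 1%:M (c *: e) 0 1%:M.
have UU : U (-1) *m U 1 = 1%:M.
  rewrite /U mulmx_block !mul1mx !mul0mx !mulmx0 !mulmx1 !addr0 add0r.
  by rewrite -scalerDl subrr scale0r -scalar_mx_block.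
have dU c : \det (U c) = 1 by rewrite det_ublock !det1 mulr1.
have -> : C = U (-1) *m (U 1 *m C) by rewrite mulmxA UU mul1mx.
apply: rescalesM.
  apply: rescales_ublock; first exact: oner_neq0.
  by apply: IH; rewrite det1 oner_neq0.
apply: corner; first by rewrite det_mulmx dU mul1r.
rewrite -[C in U 1 *m C]submxK /U mulmx_block !mul1mx scale1r.
have E (D : 'M[R]_(1 + k)) : D 0 0 = ulsubmx D 0 0.
  by rewrite !mxE; congr (D _ _); exact/val_inj.
by rewrite E block_mxKul mxE -E (eqP C0) add0r -rowE mxE.
Qed.

Lemma row_volume_affine k (S : set 'rV[R]_k) (B : 'M[R]_k) (b : 'rV[R]_k) :
  \det B != 0 -> row_measurable S ->
  row_volume [set v | S (v *m B + b)] = (`|\det B|^-1%:E * row_volume S)%E.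
Proof.
move=> /rescales_unit hB mS.
by rewrite (hB [set v | S (v + b)]) ?row_volume_translate//;
  exact: row_measurable_translate.
Qed.

Lemma row_volume_le k (S S' : set 'rV[R]_k) : row_measurable S ->
  row_measurable S' -> S `<=` S' ->
  (row_volume S <= row_volume S')%E.
Proof. by move=> mS mS' SS'; apply: le_measure; rewrite ?inE// => t /SS'. Qed.

Lemma row_measurable_forall k (I : finType) (S : I -> set 'rV[R]_k) :
  (forall i, row_measurable (S i)) -> row_measurable [set v | forall i, S i v].
Proof.
move=> mS; rewrite /row_measurable.
rewrite (_ : _ @^-1` _ = \bigcap_(i in [set: I]) (@row_of_tuple k @^-1` S i));
  last first.
  by apply/seteqP; split => t /= H => [i _|i]; exact: H.
by apply: (@fin_bigcap_measurable _ (k.-tuple T) I) => [|i _];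
  [exact: finite_finset|exact: mS].
Qed.

Lemma row_measurableI k (S S' : set 'rV[R]_k) : row_measurable S ->
  row_measurable S' -> row_measurable (S `&` S').
Proof. exact: measurableI. Qed.

Lemma row_measurable_halfspace k (u : 'cV[R]_k) (c : R) :
  row_measurable [set v | (v *m u) 0 0 <= c].
Proof.
have := @row_measurable_mul k 1 [set v : 'rV_1 | v 0 0 <= c] u; apply.
rewrite /row_measurable (_ : _ @^-1` _ = [set t : 1.-tuple T | tnth t 0 <= c]);
  last first.
  by apply/seteqP; split => t; rewrite /preimage /= mxE.
rewrite -[X in measurable X]setTI.
apply: measurable_fun_le => //.
exact: (@measurable_tnth _ T).
Qed.

Definition simplex k (r : R) : set 'rV[R]_k :=
  [set v | (forall i, 0 <= v 0 i) /\ \sum_i v 0 i <= r].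
Arguments simplex : clear implicits.

Lemma row_measurable_simplex k r : row_measurable (simplex k r).
Proof.
rewrite (_ : simplex k r = [set v | forall i,
  (v *m (- delta_mx i 0 : 'cV[R]_k)) 0 0 <= 0] `&`
    [set v | (v *m (const_mx 1 : 'cV[R]_k)) 0 0 <= r]).
  by apply: row_measurableI; [apply: row_measurable_forall => i|];
    exact: row_measurable_halfspace.
have E1 (v : 'rV[R]_k) i : (v *m (- delta_mx i 0 : 'cV[R]_k)) 0 0 = - v 0 i.
  by rewrite mulmxN -colE !mxE.
have E2 (v : 'rV[R]_k) : (v *m (const_mx 1 : 'cV[R]_k)) 0 0 = \sum_i v 0 i.
  by rewrite mxE; apply: eq_bigr => i _; rewrite mxE mulr1.
apply/seteqP; split => v /=; rewrite E2 => -[h1 h2]; split => // i.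
  by rewrite E1 oppr_le0.
by rewrite -oppr_le0 -E1.
Qed.

(** For r >= 0 the exact volume is r^k / k!, a term of the exponential series.
    The weaker bound by e^r has a shorter induction: fixing the first coordinate x >= 0
    leaves the simplex of size r - x, and e^(r - x) integrates to e^r over these x. *)
Lemma row_volume_simplex k r : (row_volume (simplex k r) <= (expR r)%:E)%E.
Proof.
elim: k r => [|k IH] r.
  rewrite /row_volume lebesgue_tuple_measureE /= diracE lee_fin.
  have [h|h] := leP 0 r.
    by rewrite (le_trans _ (expR_ge1Dx r))// (@le_trans _ _ 1) ?lerDl// lern1 leq_b1.
  rewrite memNset ?expR_ge0// => -[_]; rewrite big_ord0; lra.
suff H : (row_volume (simplex (1 + k) r) <= (expR r)%:E)%E by exact: H.
rewrite row_volume_slice.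
(* The kernel e^(r - x) on x >= 0 is e^r times the exponential density. *)
have pdf1 := integral_exponential_pdf (@ltr01 R).
apply: (@le_trans _ _ (\int[leb]_x ((expR r)%:E * (exponential_pdf 1 x)%:E))%E);
  last first.
  rewrite ge0_integralZl//.
  - by rewrite [X in (_ * X)%E]pdf1 mule1.
  - by apply/measurable_EFinP; exact: measurable_exponential_pdf.
  - by move=> x _; rewrite lee_fin exponential_pdf_ge0.
apply: ge0_le_integral => //.
- exact: (measurable_row_volume_slice (row_measurable_simplex r)).
- by apply: measurable_funeM; apply/measurable_EFinP; exact: measurable_exponential_pdf.
move=> x _.
have sE : slice (simplex (1 + k) r) x = [set v | 0 <= x /\ simplex k (r - x) v].
  apply/seteqP; split => v; rewrite /slice /simplex /= big_split_ord /= big_ord1.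
    move=> [h1 h2]; split.
      by have := h1 (lshift k 0); rewrite row_mxEl mxE mulr1n.
    split => [i|]; first by have := h1 (rshift 1 i); rewrite row_mxEr.
    rewrite lerBrDl; move: h2; rewrite row_mxEl mxE mulr1n.
    by under eq_bigr do rewrite row_mxEr.
  move=> [x0 [h1 h2]]; split => [i|].
    by case: (split_ordP i) => j ->; rewrite ?row_mxEl ?row_mxEr// ord1 mxE mulr1n.
  rewrite row_mxEl mxE mulr1n -lerBrDl.
  by under eq_bigr do rewrite row_mxEr.
have [x0|x0] := leP 0 x.
  rewrite [X in row_volume X](_ : _ = simplex k (r - x)); last first.
    by rewrite [LHS]sE; apply/seteqP; split => v; [case|].
  apply: le_trans (IH _) _.
  rewrite -EFinM exponential_pdfE//  mul1r mulN1r -expRD //.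
rewrite [X in row_volume X](_ : _ = set0); last first.
  by rewrite [LHS]sE; apply/seteqP; split => v // -[]; rewrite leNgt x0.
by rewrite /row_volume preimage_set0 measure0 mule_ge0// lee_fin ?expR_ge0
  ?exponential_pdf_ge0.
Qed.

End coordinates.

(** * Determinants, symmetric matrices and products of eigenvalues *)

(** The matrix with blocks 1, -v, u, 1 can be reduced to block triangular form by
    eliminating u either with rows or with columns. *)
Lemma det_rank1_update (F : comNzRingType) k (u : 'cV[F]_k) (v : 'rV[F]_k) :
  \det (1%:M + u *m v) = 1 + (v *m u) 0 0.
Proof.
transitivity (\det (block_mx 1%:M (- v) u 1%:M : 'M[F]_(1 + k))).
  have -> : block_mx 1%:M (- v) u 1%:M =
      block_mx 1%:M 0 u 1%:M *m block_mx 1%:M (- v) 0 (1%:M + u *m v) :> 'M[F]_(1 + k).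
    by rewrite mulmx_block !mul1mx !mulmx1 !mul0mx !addr0 mulmxN addrC addrK.
  by rewrite det_mulmx det_lblock det_ublock !det1 !mul1r.
have -> : block_mx 1%:M (- v) u 1%:M =
    block_mx (1%:M + v *m u) (- v) 0 1%:M *m block_mx 1%:M 0 u 1%:M :> 'M[F]_(1 + k).
  by rewrite mulmx_block !mul1mx !mulmx1 !mul0mx !mulmx0 !add0r mulNmx addrK.
rewrite det_mulmx det_lblock det_ublock !det1 !mulr1 [X in \det X]mx11_scalar
  det_scalar1.
by rewrite mxE mxE eqxx.
Qed.

Lemma mxminpoly_similar (F : fieldType) k (P D : 'M[F]_k.+1) : P \in unitmx ->
  mxminpoly (invmx P *m D *m P) = mxminpoly D.
Proof.
move=> Pu; have <- := conjVmx D Pu.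
by rewrite mxminpoly_uconj// unitmx_inv.
Qed.

Section complexification.
Import complex.
Local Open Scope complex_scope.

(** Over the complex numbers the spectral theorem applies to the Hermitian
    matrix A, and its eigenvalues are real.  Hence the minimal polynomial of A,
    which does not change under field extension, is a product of distinct real
    linear factors, and this already forces diagonalizability over R. *)
Lemma symmetric_eigenbasis (R : rcfType) k (A : 'M[R]_k) : A^T = A ->
  exists P (d : 'I_k -> R), P \in unitmx /\ forall i, row i P *m A = d i *: row i P.
Proof.
case: k A => [|k] A As.
  by exists 1%:M, (fun=> 0); split; [exact: unitmx1|case].
pose f := @real_complex R : {rmorphism R -> R[i]}.
pose AC := map_mx f A.
have hA : AC \is hermsymmx.
  rewrite qualifE expr0 scale1r; apply/eqP/matrixP => i j; rewrite !mxE.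
  by rewrite -[in RHS]As mxE conj_Creal//; apply/complex_realP; exists (A i j).
have sR := hermitian_spectral_diag_real hA.
have /orthomx_spectralP := hermitian_normalmx hA.
move: sR (spectral_unit AC); move: (spectralmx AC) (spectral_diag AC) => P sp sR Pu AE.
have pAC : mxminpoly AC = mxminpoly (diag_mx sp).
  by rewrite AE mxminpoly_similar.
have rE i : exists x : R, sp 0 i = x%:C.
  by have /complex_realP[x xE] := mxOverP sR 0 i; exists x.
have [d dE] := choice rE.
have /diagonalizableP[P' P'u /diagonalizable_forPex[D /(simmxP P'u) PD]] :
    exists2 rs, uniq rs & mxminpoly A %| \prod_(x <- rs) ('X - x%:P).
  exists (undup [seq d i | i <- enum 'I_k.+1]); first exact: undup_uniq.
  rewrite -(dvdp_map f) -mxminpoly_map pAC mxminpoly_diag.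
  rewrite rmorph_prod /=; under [X in _ %| X]eq_bigr do rewrite map_polyXsubC.
  rewrite (_ : [seq sp 0 i | i <- _] = [seq f x | x <- [seq d i | i <- enum 'I_k.+1]]).
    by rewrite (undup_map_inj (fmorph_inj f)) big_map; exact: dvdpp.
  rewrite (eq_map dE); exact: (map_comp f d).
exists P', (D 0); split; [exact: P'u|move=> i].
by rewrite -row_mul PD row_mul row_diag_mx -scalemxAl -rowE.
Qed.

End complexification.

(** In a basis of eigenvectors the eigenspace of a is spanned by the basis
    vectors of eigenvalue a, so the exponent of a is its number of occurrences. *)
Section eigenbasis.
Context (R : realType) (V : vectType R) (L : 'End(V)).
Context (k : nat) (e : 'I_k -> V) (d : 'I_k -> R).
Let b := [tuple e i | i < k].
Hypotheses (b_basis : basis_of {:V} b) (Le : forall i, L (e i) = d i *: e i).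

Let eig a := [seq e i | i <- [seq i <- enum 'I_k | d i == a]].

Let eig_free a : free (eig a).
Proof.
have := basis_free b_basis.
rewrite (@perm_free _ _ _ (eig a ++ [seq e i | i <- [seq i <- enum 'I_k | d i != a]])).
  by move=> /catl_free.
by rewrite -map_cat; apply: perm_map; rewrite perm_sym perm_filterC.
Qed.

Lemma leigenspace_eigenbasis a : passmx.leigenspace L a = <<eig a>>%VS.
Proof.
apply/eqP; rewrite eqEsubv; apply/andP; split; last first.
  apply/span_subvP => v /mapP[j]; rewrite mem_filter => /andP[/eqP da _] ->.
  by rewrite memv_ker add_lfunE opp_lfunE scale_lfunE id_lfunE Le da subrr.
apply/subvP => v; rewrite memv_ker add_lfunE opp_lfunE scale_lfunE id_lfunE subr_eq0
  => /eqP Lv.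
have vE := coord_basis b_basis (memvf v).
have c0 i : d i != a -> coord b i v = 0.
  move=> da; have : coord b i (L v) = coord b i (a *: v) by rewrite Lv.
  rewrite linearZ /= {1}vE linear_sum /=.
  under eq_bigr do rewrite linearZ /= nth_mktuple Le scalerA -(nth_mktuple e 0).
  rewrite coord_sum_free ?(basis_free b_basis)// => /eqP.
  by rewrite mulrC -subr_eq0 -mulrBl mulf_eq0 subr_eq0 (negPf da) => /eqP.
rewrite vE rpred_sum// => i _.
have [da|da] := eqVneq (d i) a; last by rewrite c0// scale0r rpred0.
rewrite rpredZ// memv_span// nth_mktuple map_f// mem_filter da eqxx /=.
by rewrite mem_enum.
Qed.

Lemma eigenvalue_prod_eigenbasis : eigenvalue_prod L = \prod_i d i.
Proof.
pose r := [seq d i | i <- enum 'I_k].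
have cE a : \dim (passmx.leigenspace L a) = count_mem a r.
  rewrite leigenspace_eigenbasis (eqnP (eig_free a)) size_map size_filter.
  by rewrite [RHS]count_map; apply: eq_count => j.
rewrite /eigenvalue_prod (_ : [set a | _] = [set` undup r]); last first.
  apply/seteqP; split => a /=; rewrite mem_undup /passmx.leigenvalue -dimv_eq0 cE;
  by rewrite -lt0n -has_count has_pred1.
rewrite -fsbig_seq ?undup_uniq//.
transitivity (\prod_(i <- r) i); last by rewrite big_map big_enum.
rewrite -[RHS](big_undup_iterop_count _ r xpredT id).
by apply: eq_bigr => a _; rewrite cE.
Qed.

End eigenbasis.

(** * Coordinates on mean-zero functions *)

Section linear_forms.
Context {R : realType}.

Lemma mulmx_col_deltas k (f : 'rV[R]_k -> R) :
  (forall a u v, f (a *: u + v) = a * f u + f v) ->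
  forall v, f v = (v *m \col_i f (delta_mx 0 i)) 0 0.
Proof.
move=> fl v; pose g : 'rV[R]_k -> R^o := f.
pose L : {linear 'rV[R]_k -> R^o} := HB.pack g (GRing.isLinear.Build _ _ _ _ g fl).
rewrite mxE {1}[v]row_sum_delta.
transitivity (L (\sum_j v 0 j *: delta_mx 0 j)) => //.
rewrite linear_sum; apply: eq_bigr => i _; rewrite mxE; exact: linearZ.
Qed.

Lemma row_measurable_linear_le k (f : 'rV[R]_k -> R) c :
  (forall a u v, f (a *: u + v) = a * f u + f v) -> row_measurable [set v | f v <= c].
Proof.
move=> /mulmx_col_deltas fE;
  have := row_measurable_halfspace (\col_i f (delta_mx 0 i)) c.
by congr row_measurable; apply/seteqP; split => v /=; rewrite -fE.
Qed.

End linear_forms.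

Section torus_coordinates.
Context {R : realType} {n : nat} (n2 : (2 <= n)%N).
Notation m := (n ^ 2 - 1)%N.
Implicit Types (x y : 'rV[R]_m) (v w : torus n).

Lemma card_torus : #|{: torus n}| = m.+1.
Proof.
by rewrite card_prod card_ord Zp_cast// mulnn subn1 prednK// expn_gt0 (ltnW n2).
Qed.

Let n0 : n%:R != 0 :> R.
Proof. by rewrite pnatr_eq0 -lt0n (ltnW n2). Qed.

Let n1 : n%:R - 1 != 0 :> R.
Proof. by rewrite subr_eq0 pnatr_eq1 neq_ltn n2 orbT. Qed.

Let natm : m%:R = n%:R ^+ 2 - 1 :> R.
Proof. by rewrite natrB ?expn_gt0 ?(ltnW n2)// natrX. Qed.

Definition vertex (k : 'I_m.+1) : torus n := enum_val (cast_ord (esym card_torus) k).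

Definition vertex_rank v : 'I_m.+1 := cast_ord card_torus (enum_rank v).

Lemma vertexK : cancel vertex vertex_rank.
Proof. by move=> k; rewrite /vertex_rank /vertex enum_valK cast_ordKV. Qed.

Lemma vertex_rankK : cancel vertex_rank vertex.
Proof. by move=> v; rewrite /vertex_rank /vertex cast_ordK enum_rankK. Qed.

Lemma sum_vertex (V : nmodType) (f : torus n -> V) :
  \sum_v f v = f (vertex ord0) + \sum_j f (vertex (lift ord0 j)).
Proof.
rewrite (reindex vertex) /=; first by rewrite big_ord_recl.
by exists vertex_rank => v _; [exact: vertexK|exact: vertex_rankK].
Qed.

(** A mean-zero function is determined by its values off the vertex of rank 0. *)
Definition extend (z : 'rV[R]_m) v : R :=
  if unlift ord0 (vertex_rank v) is Some j then z 0 j else - \sum_j z 0 j.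

Lemma extendS z j : extend z (vertex (lift ord0 j)) = z 0 j.
Proof. by rewrite /extend vertexK liftK. Qed.

Lemma extend0 z : extend z (vertex ord0) = - \sum_j z 0 j.
Proof. by rewrite /extend vertexK unlift_none. Qed.

Lemma extend_coord (f : torus n -> R) : \sum_v f v = 0 ->
  f = extend (\row_j f (vertex (lift ord0 j))).
Proof.
rewrite sum_vertex => f0; apply/funext => v; rewrite -(vertex_rankK v).
case: (unliftP ord0 (vertex_rank v)) => [j|] ->; first by rewrite extendS mxE.
rewrite extend0; under eq_bigr do rewrite mxE.
by move/eqP: f0; rewrite addr_eq0 => /eqP.
Qed.

Lemma extend_linear a z z' v : extend (a *: z + z') v = a * extend z v + extend z' v.
Proof.
rewrite /extend; case: unlift => [j|]; first by rewrite !mxE.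
rewrite mulrN mulr_sumr -opprD -big_split /=.
by congr (- _); apply: eq_bigr => j _; rewrite !mxE.
Qed.

(** The passage from the isometric coordinates of meanzero_coord to the values
    off the vertex of rank 0; a rank one perturbation of the identity. *)
Definition tilt : 'M[R]_m :=
  1%:M + const_mx (- (n%:R * (n%:R - 1))^-1) *m (const_mx 1 : 'rV_m).

Lemma tilt_coord x j : (x *m tilt) 0 j = x 0 j - (\sum_i x 0 i) / (n%:R * (n%:R - 1)).
Proof.
rewrite mulmxDr mulmx1 mxE mulmxA mxE big_ord1 [X in _ + _ * X]mxE mulr1; congr (_ + _).
rewrite mxE mulr_suml -sumrN; apply: eq_bigr => i _.
by rewrite mxE mulrN.
Qed.

Lemma det_tilt : \det tilt = - n%:R^-1.
Proof.
rewrite det_rank1_update mxE; under eq_bigr do rewrite !mxE mul1r.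
rewrite sumr_const card_ord -[_ *+ (_ - 1)]mulr_natr natm; field; exact/andP.
Qed.

Lemma tilt_unit : tilt \in unitmx.
Proof. by rewrite unitmxE det_tilt unitfE oppr_eq0 invr_eq0. Qed.

Definition meanzero_row x : torus n -> R := extend (x *m tilt).

Lemma meanzero_row_linear a x y v : meanzero_row (a *: x + y) v =
  a * meanzero_row x v + meanzero_row y v.
Proof. by rewrite /meanzero_row mulmxDl -scalemxAl extend_linear. Qed.

Lemma meanzero_coordE (t : m.-tuple R) : meanzero_coord t =
  meanzero_row (row_of_tuple t).
Proof.
have tE i : tnth t i = t`_i by rewrite (tnth_nth 0).
have SE : \sum_(u <- t) u = \sum_i row_of_tuple t 0 i.
  rewrite (big_nth 0) big_mkord size_tuple.
  by apply: eq_bigr => i _; rewrite mxE tE.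
apply/funext => v; rewrite -(vertex_rankK v) /meanzero_coord.
rewrite (_ : val (enum_rank _) = val (vertex_rank v)); last first.
  by rewrite vertex_rankK.
case: (unliftP ord0 (vertex_rank v)) => [j|] ->.
  by rewrite /meanzero_row extendS tilt_coord mxE tE SE.
rewrite /meanzero_row extend0 (eq_bigr _ (fun j _ => tilt_coord (row_of_tuple t) j)).
rewrite SE sumrB sumr_const card_ord -[_ *+ (_ - 1)]mulr_natr natm.
set S := \sum_i _; field; exact/andP.
Qed.

Lemma row_of_tuple_surj x : exists t : m.-tuple R, row_of_tuple t = x.
Proof.
exists [tuple x 0 i | i < m]; apply/rowP => i.
by rewrite mxE tnth_mktuple.
Qed.

Lemma sum_meanzero_row x : \sum_v meanzero_row x v = 0.
Proof. by have [t <-] := row_of_tuple_surj x;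
  rewrite -meanzero_coordE sum_meanzero_coord. Qed.

Lemma meanzero_row_surj (f : torus n -> R) : \sum_v f v = 0 ->
  exists x, f = meanzero_row x.
Proof.
move=> /extend_coord ->; set z := \row_j _; exists (z *m invmx tilt).
by rewrite /meanzero_row mulmxKV// tilt_unit.
Qed.

Lemma meanzero_row_isometry x : \sum_v meanzero_row x v ^+ 2 = \sum_i x 0 i ^+ 2.
Proof.
have [t <-] := row_of_tuple_surj x; rewrite -meanzero_coordE meanzero_coord_isometry//.
rewrite (big_nth 0) big_mkord size_tuple.
by apply: eq_bigr => i _; rewrite mxE (tnth_nth 0).
Qed.

(** Polarization of the isometry. *)
Lemma meanzero_row_dot x y : \sum_v meanzero_row x v * meanzero_row y v =
  \sum_i x 0 i * y 0 i.
Proof.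
have := meanzero_row_isometry (1 *: x + y).
under eq_bigr do rewrite meanzero_row_linear mul1r sqrrD.
rewrite !big_split /= !meanzero_row_isometry.
under [in RHS]eq_bigr do rewrite !mxE mul1r sqrrD.
rewrite !big_split /= => /addIr /addrI; lra.
Qed.

Lemma meanzero_row_coord x i :
  \sum_v meanzero_row x v * meanzero_row (delta_mx 0 i) v = x 0 i.
Proof.
rewrite meanzero_row_dot (bigD1 i)//= big1 ?addr0 ?mxE ?eqxx ?mulr1// => j ji.
by rewrite mxE (negPf ji) andbF mulr0.
Qed.

Definition meanzero_ffun x : {ffun torus n -> R^o} := [ffun v => meanzero_row x v].

Lemma meanzero_ffun_linear : linear meanzero_ffun.
Proof. by move=> a x y; apply/ffunP => v; rewrite !ffunE meanzero_row_linear. Qed.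

HB.instance Definition _ := GRing.isLinear.Build _ _ _ _ meanzero_ffun
  meanzero_ffun_linear.

Lemma meanzero_ffun_meanzero x : meanzero_ffun x \in meanzero R n.
Proof.
rewrite meanzeroE; apply/eqP; rewrite -[RHS](sum_meanzero_row x).
by apply: eq_bigr => v _; rewrite ffunE.
Qed.

Lemma meanzero_ffun_surj f : f \in meanzero R n -> exists x, f = meanzero_ffun x.
Proof.
rewrite meanzeroE => /eqP /meanzero_row_surj[x fE]; exists x.
by apply/ffunP => v; rewrite ffunE -fE.
Qed.

Lemma meanzero_ffun_inj x y : meanzero_ffun x = meanzero_ffun y -> x = y.
Proof.
move=> /ffunP xy; apply/rowP => i; rewrite -!meanzero_row_coord.
by apply: eq_bigr => v _; have := xy v; rewrite !ffunE => ->.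
Qed.

Section convolution_matrix.
Context (K : {ffun torus n -> R^o}) (K_even : forall v, K (- v) = K v).

(** The coordinates are orthonormal, so the entries of the matrix of an operator
    are inner products; symmetry of the operator becomes symmetry of the
    matrix. *)
Definition convol_mx : 'M[R]_m :=
  \matrix_(i, j) \sum_v convol K (meanzero_ffun (delta_mx 0 i)) v * meanzero_row
    (delta_mx 0 j) v.

Lemma convol_meanzero_row x : convol K (meanzero_ffun x) =
  meanzero_ffun (x *m convol_mx).
Proof.
have [y yE] := meanzero_ffun_surj (convol_meanzero K (meanzero_ffun_meanzero x)).
rewrite yE; congr meanzero_ffun; apply/rowP => j; rewrite -meanzero_row_coord.
transitivity (\sum_v convol K (meanzero_ffun x) v * meanzero_row (delta_mx 0 j) v).
  by apply: eq_bigr => v _; rewrite yE ffunE.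
rewrite mxE {1}[x]row_sum_delta !linear_sum /=.
under eq_bigr do rewrite sum_ffunE mulr_suml.
rewrite exchange_big /=; apply: eq_bigr => i _.
rewrite mxE mulr_sumr; apply: eq_bigr => v _.
by rewrite !linearZ /= ffunE mulrA.
Qed.

Lemma convol_mx_sym : convol_mx^T = convol_mx.
Proof.
apply/matrixP => i j; rewrite !mxE.
under eq_bigr do rewrite ffunE mulr_suml.
under [RHS]eq_bigr do rewrite ffunE mulr_suml.
rewrite exchange_big /=; apply: eq_bigr => u _; apply: eq_bigr => v _.
by rewrite !ffunE -K_even opprB; ring.
Qed.

(** An eigenbasis of the symmetric matrix gives an eigenbasis of the operator,
    and both sides are the product of its eigenvalues. *)
Lemma eigenvalue_prod_convol :
  eigenvalue_prod (convol_meanzero_op K) = \det convol_mx.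
Proof.
have [P [d [Pu Pd]]] := symmetric_eigenbasis convol_mx_sym.
pose e i : subvs_of (meanzero R n) := vsproj (meanzero R n) (meanzero_ffun (row i P)).
have eE i : vsval (e i) = meanzero_ffun (row i P) by rewrite vsprojK
  ?meanzero_ffun_meanzero.
rewrite (@eigenvalue_prod_eigenbasis _ _ _ _ e d).
- have : P *m convol_mx = diag_mx (\row_i d i) *m P.
    by apply/row_matrixP => i; rewrite !row_mul Pd row_diag_mx -scalemxAl -rowE mxE.
  move=> /(congr1 (fun A => \det A)); rewrite !det_mulmx det_diag mulrC => /mulIf ->.
    by apply: eq_bigr => i _; rewrite mxE.
  by rewrite -unitfE -unitmxE.
- have combE (k : 'rV[R]_m) : vsval (\sum_i k 0 i *: e i) = meanzero_ffun (k *m P).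
    rewrite linear_sum mulmx_sum_row linear_sum; apply: eq_bigr => i _.
    by rewrite !linearZ /= eE.
  apply/andP; split.
    rewrite eqEsubv subvf; apply/subvP => f _.
    have [x fE] := meanzero_ffun_surj (subvsP f).
    have -> : f = \sum_i (x *m invmx P) 0 i *: e i.
      by apply: val_inj; rewrite [RHS]combE mulmxKV.
    apply: rpred_sum => i _; apply: rpredZ; apply: memv_span.
    by rewrite map_f// mem_enum.
  apply/freeP => k k0 i.
  have kP : meanzero_ffun ((\row_i k i) *m P) = meanzero_ffun 0.
    rewrite -combE linear0 (_ : \sum_i _ = 0) ?linear0// -[RHS]k0.
    by apply: eq_bigr => j _; rewrite mxE nth_mktuple.
  have /(congr1 (mulmx^~ (invmx P))) := meanzero_ffun_inj kP.
  by rewrite mulmxK// mul0mx => /rowP/(_ i); rewrite !mxE.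
- move=> i; apply: val_inj;
  rewrite /= convol_meanzero_opE [in LHS]eE convol_meanzero_row.
  by rewrite Pd !linearZ /= eE.
Qed.

End convolution_matrix.

End torus_coordinates.

(** * The polytope and its volume *)

Lemma hess_linear (R : realType) n (f g : torus n -> R) a r v :
  hess (fun u => a * f u + g u) r v = a * hess f r v + hess g r v.
Proof.
by case: v => p q; rewrite /hess /D0 /D1 /D2; case: (val r) => [|[|?]]; ring.
Qed.

Section row_volume_sets.
Context {R : realType} {k : nat}.

Lemma row_volume_setD (S S' : set 'rV[R]_k) : row_measurable S ->
  row_measurable S' -> S' `<=` S ->
  (row_volume S < +oo)%E -> row_volume (S `\` S') = (row_volume S - row_volume S')%E.
Proof.
move=> mS mS' SS' fS; have := measureD mS mS' fS.
by rewrite -preimage_setI (setIidr SS').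
Qed.

Lemma row_volume_disjoint_cover l (A : 'I_l -> set 'rV[R]_k) S : row_measurable S ->
  (forall i, row_measurable (A i)) -> (forall i, A i `<=` S) ->
  (forall i j x, A i x -> A j x -> i = j) ->
    (\sum_i row_volume (A i) <= row_volume S)%E.
Proof.
move=> mS mA AS Ad.
have mU : measurable (\big[setU/set0]_(i < l) ((@row_of_tuple R k) @^-1` A i)).
  by apply: bigsetU_measurable => i _; exact: mA.
rewrite -[leLHS](@measure_semi_additive_ord _ _ _ (lebesgue_tuple_measure k) l
  (fun i => (@row_of_tuple R k) @^-1` A i))//.
  apply: le_measure; rewrite ?inE//.
  by rewrite -bigcup_seq => t [i _] /AS.
by apply/trivIsetP => i j _ _ /eqP ij; apply/seteqP; split => t // -[/Ad/[apply]].
Qed.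

End row_volume_sets.

Section polytope.
Context {R : realType} {n : nat} (n2 : (2 <= n)%N).
Notation m := (n ^ 2 - 1)%N.
Implicit Types (s : 'rV[R]_3) (x : 'rV[R]_m).

(** The inequalities of hess_polytope in isometric coordinates, where having mean
    zero is automatic. *)
Definition polytope s : set 'rV[R]_m :=
  [set x | forall vr : torus n * 'I_3, hess (meanzero_row n2 x) vr.2 vr.1 <= s 0 vr.2].

Lemma hess_meanzero_linear a x y r v :
  hess (meanzero_row n2 (a *: x + y)) r v =
    a * hess (meanzero_row n2 x) r v + hess (meanzero_row n2 y) r v.
Proof.
by rewrite -hess_linear; congr hess; apply/funext => u; exact: meanzero_row_linear.
Qed.

Lemma hess_meanzeroZ a x r v : hess (meanzero_row n2 (a *: x)) r v =
  a * hess (meanzero_row n2 x) r v.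
Proof.
have h0 : hess (meanzero_row n2 (0 : 'rV[R]_m)) r v = 0.
  by have := hess_meanzero_linear 1 0 0 r v; rewrite scaler0 addr0 mul1r; lra.
by rewrite -[a *: x]addr0 hess_meanzero_linear h0 addr0.
Qed.

Lemma row_measurable_polytope s : row_measurable (polytope s).
Proof.
apply: row_measurable_forall => -[v r]; apply: row_measurable_linear_le => a x y;
  exact: hess_meanzero_linear.
Qed.

Lemma volE s : vol n s = fine (row_volume (polytope s)).
Proof.
rewrite /vol /row_volume lebesgue_tuple_measureE; congr (fine (lebesgue_tuple _)).
apply/seteqP; split => t /=; rewrite /preimage /= /hess_polytope /= meanzero_coordE.
  by move=> [_ h] [v r]; exact: h.
by move=> h; split => [|v r]; [exact: sum_meanzero_row|exact: (h (v, r))].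
Qed.

Lemma polytope_le s s' : (forall r, s 0 r <= s' 0 r) -> polytope s `<=` polytope s'.
Proof. by move=> ss' x xs vr; exact: le_trans (xs vr) (ss' _). Qed.

Lemma row_volume_polytope_le s s' : (forall r, s 0 r <= s' 0 r) ->
  (row_volume (polytope s) <= row_volume (polytope s'))%E.
Proof.
by move=> ss'; apply: row_volume_le;
  [exact: row_measurable_polytope..|exact: polytope_le].
Qed.

Lemma row_volume_polytopeZ c s : 0 < c ->
  row_volume (polytope (c *: s)) = ((c ^+ m)%:E * row_volume (polytope s))%E.
Proof.
move=> c0; have ci0 : c^-1 != 0 by rewrite invr_eq0 gt_eqF.
have -> : polytope (c *: s) = [set x | polytope s (x *m (c^-1)%:M + 0)].
  by apply/seteqP; split => x h vr; move: (h vr);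
    rewrite addr0 mul_mx_scalar hess_meanzeroZ mxE ler_pdivrMl.
rewrite row_volume_affine; last exact: row_measurable_polytope.
  by rewrite det_scalar normrX normfV gtr0_norm// exprVn invrK.
by rewrite det_scalar expf_neq0.
Qed.

(** Throughout, push h r relaxes the constraints of the family r only, from s_r to
    (1 + h) s_r.  Finiteness of the volume of P_n(s) passes to the relaxed
    polytopes because they lie in P_n((1 + h) s), a dilate of P_n(s). *)
Section increments.
Context (s : 'rV[R]_3) (s_gt0 : forall r, 0 < s 0 r).
Hypothesis s_fin : (row_volume (polytope s) < +oo)%E.

Let push (h : R) (i : 'I_3) : 'rV[R]_3 := h * s 0 i *: delta_mx 0 i + s.

Let pushE h i r : push h i 0 r = s 0 r + h * s 0 r *+ (r == i).
Proof.
by rewrite !mxE eqxx /= addrC; case: eqVneq => [->|_]; rewrite ?mulr1 ?mulr0// mulr0n.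
Qed.

Let push_le h i : 0 <= h -> forall r, s 0 r <= push h i 0 r.
Proof.
by move=> h0 r; rewrite pushE lerDl mulrn_wge0// mulr_ge0// ltW.
Qed.

Let push_ge h i : 0 <= h -> forall r, push h i 0 r <= ((1 + h) *: s) 0 r.
Proof.
move=> h0 r; rewrite pushE mxE mulrDl mul1r lerD2l.
by case: (r == i) => //; rewrite mulr0n mulr_ge0// ltW.
Qed.

Let scaled_fin h : 0 <= h -> (row_volume (polytope ((1 + h) *: s)) < +oo)%E.
Proof.
move=> h0; rewrite row_volume_polytopeZ ?ltr_pwDl//.
by rewrite lte_mul_pinfty// lee_fin exprn_ge0// addr_ge0.
Qed.

Let finE s' : (row_volume (polytope s') < +oo)%E ->
  row_volume (polytope s') = (vol n s')%:E.
Proof.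
by move=> f; rewrite volE fineK// ge0_fin_numE//; exact: measure_ge0.
Qed.

Let push_fin h i : 0 <= h -> (row_volume (polytope (push h i)) < +oo)%E.
Proof.
move=> h0; apply: le_lt_trans (scaled_fin h0).
exact: row_volume_polytope_le (push_ge i h0).
Qed.

Lemma vol_le_push h i : 0 <= h -> vol n s <= vol n (h * s 0 i *: delta_mx 0 i + s).
Proof.
move=> h0; rewrite -lee_fin -!finE//; last exact: push_fin.
exact: row_volume_polytope_le (push_le i h0).
Qed.

(** The functions gained by relaxing the family i satisfy all constraints of the
    other families, so a function gained twice would have been in P_n(s). *)
Lemma sum_vol_increments h : 0 <= h ->
  \sum_i (vol n (h * s 0 i *: delta_mx 0 i + s) - vol n s) <= ((1 + h) ^+ m - 1) *
    vol n s.
Proof.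
move=> h0.
pose A (i : 'I_3) := polytope (push h i) `\` polytope s.
have mA i : row_measurable (A i) by apply: measurableD; exact: row_measurable_polytope.
have vA i : row_volume (A i) = (vol n (push h i) - vol n s)%:E.
  have sub := polytope_le (push_le i h0).
  rewrite (row_volume_setD (row_measurable_polytope _) (row_measurable_polytope _)
    sub (push_fin i h0)).
  by rewrite (finE (push_fin i h0)) (finE s_fin).
rewrite -lee_fin -sumEFin; under eq_bigr do rewrite -vA.
have -> : (((1 + h) ^+ m - 1) * vol n s)%:E =
    row_volume (polytope ((1 + h) *: s) `\` polytope s).
  have sub : polytope s `<=` polytope ((1 + h) *: s).
    by apply: polytope_le => r; rewrite mxE mulrDl mul1r lerDl mulr_ge0// ltW.
  rewrite (row_volume_setD (row_measurable_polytope _) (row_measurable_polytope _)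
    sub (scaled_fin h0)).
  rewrite row_volume_polytopeZ; last by rewrite ltr_pwDl.
  by rewrite (finE s_fin) -EFinM -EFinD mulrBl mul1r.
apply: row_volume_disjoint_cover.
- by apply: measurableD; exact: row_measurable_polytope.
- exact: mA.
- by move=> i; apply: setSD; exact: polytope_le (push_ge i h0).
move=> i j x [xi xs] [xj _]; apply: contra_notP xs => /eqP ij [v r].
have := xi (v, r); have := xj (v, r); rewrite !pushE /=.
have [->|_] := eqVneq r i; last by rewrite mulr0n addr0.
by rewrite (negPf ij) mulr0n addr0.
Qed.

End increments.

End polytope.

(** * The weights *)

(** The sequence r is a lower bound for scaled difference quotients with steps
    c / (i + 1).  Where the derivative exists, r consists of these quotients;
    where it does not, it has the default value 0, and r is the zero sequence,
    which is a lower bound because f increases along v. *)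
Lemma derive_right_quotient (R : realType) k (f : 'rV[R]_k -> R)
    (s v : 'rV[R]_k) (c : R) :
  0 < c -> (forall t, 0 <= t -> f s <= f (t *: v + s)) ->
  0 <= 'D_v f s /\ exists2 r : R^nat, r i @[i --> \oo] --> c * 'D_v f s &
    forall i, r i <= i.+1%:R * (f (i.+1%:R^-1 * c *: v + s) - f s).
Proof.
move=> c0 fle.
have hi i : 0 < (i.+1%:R^-1 : R) by rewrite invr_gt0.
have [D|ND] := pselect (derivable f s v); last first.
  have -> : 'D_v f s = 0 by rewrite /derive dvgP.
  split; first exact: lexx.
  exists (fun=> 0); first by rewrite mulr0; exact: cvg_cst.
  by move=> i; rewrite mulr_ge0// subr_ge0 fle// mulr_ge0 ?ltW.
pose q h := h^-1 *: ((f \o shift s) (h *: v) - f s).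
have qD : q h @[h --> 0^'+] --> 'D_v f s := cvg_dnbhs_at_right D.
have qE h : q h = h^-1 * (f (h *: v + s) - f s) by [].
have q0 h : 0 < h -> 0 <= q h.
  by move=> h0; rewrite qE mulr_ge0 ?invr_ge0 ?subr_ge0 ?fle// ltW.
pose u i : R := i.+1%:R^-1 * c.
have u0 i : 0 < u i by rewrite mulr_gt0.
have ucvg : u i @[i --> \oo] --> (0 : R).
  rewrite -(mul0r c); apply: cvgMl; exact: cvg_harmonic.
have quD := (cvg_at_rightP q 0 ('D_v f s)).1 qD u (conj u0 ucvg).
split.
  rewrite -(cvg_lim _ quD)//; apply: limr_ge; first by apply/cvg_ex; exists ('D_v f s).
  by apply: nearW => i; exact: q0.
exists (fun i => c * q (u i)); first exact: cvgMr.
move=> i; rewrite qE /u invfM invrK -mulrA mulrCA.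
by rewrite [X in _ * X]mulrA divff ?gt_eqF// mul1r.
Qed.

Section weights.
Context {R : realType} {n : nat} (n2 : (2 <= n)%N).
Notation m := (n ^ 2 - 1)%N.
Context (s : 'rV[R]_3) (s_gt0 : forall r, 0 < s 0 r).
Hypothesis s_fin : (row_volume (polytope n2 s) < +oo)%E.

(** Along h = 1 / (i + 1), the sum of the s_r-scaled difference quotients is at
    most ((1 + h)^m - 1) / h times the volume, and ((1 + h)^m - 1) / h is the
    sum of (1 + h)^k for k < m, which tends to m. *)
Lemma weights_ge0_sum_le : (forall r, 0 <= weights n s 0 r) /\
  \sum_r s 0 r * weights n s 0 r <= m%:R / (n ^ 2)%:R * vol n s.
Proof.
have mono r t : 0 <= t -> vol n s <= vol n (t *: delta_mx 0 r + s).
  move=> t0; rewrite -[t](divfK (lt0r_neq0 (s_gt0 r))).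
  by apply: (vol_le_push s_gt0 s_fin); rewrite divr_ge0// ltW.
have DE r := derive_right_quotient (s_gt0 r) (mono r).
have D0 r := (DE r).1.
have n20 : 0 <= (n ^ 2)%:R^-1 :> R by rewrite invr_ge0.
split; first by move=> r; rewrite mxE mulr_ge0.
under eq_bigr do rewrite mxE mulrCA.
rewrite -mulr_sumr (mulrC m%:R) -mulrA ler_wpM2l//.
have [rho rhoD rho_le] : exists2 rho : 'I_3 -> R^nat,
    (forall r, rho r i @[i --> \oo] --> s 0 r * 'D_(delta_mx 0 r) (vol n) s) &
    forall r i, rho r i <= i.+1%:R * (vol n (i.+1%:R^-1 * s 0 r *: delta_mx 0 r + s)
      - vol n s).
  have /choice[rho rhoP] : forall r, exists u : R^nat,
     u i @[i --> \oo] --> s 0 r * 'D_(delta_mx 0 r) (vol n) s /\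
     forall i, u i <= i.+1%:R * (vol n (i.+1%:R^-1 * s 0 r *: delta_mx 0 r + s) - vol
       n s).
    by move=> r; have [_ [u u1 u2]] := DE r; exists u.
  by exists rho => r; case: (rhoP r).
pose g (i : nat) : R := (\sum_(k < m) (1 + i.+1%:R^-1) ^+ k) * vol n s.
have gcvg : g i @[i --> \oo] --> m%:R * vol n s.
  apply: cvgMl; rewrite -[m in m%:R]card_ord -sum1_card natr_sum.
  apply: cvg_big => [|k _]; [exact: add_continuous|]; rewrite -[1%:R](expr1n _ k).
  apply: (@continuous_cvg _ _ _ _ _ (fun i : nat => 1 + i.+1%:R^-1 : R) (fun x : R =>
    x ^+ k) 1); first exact: exprn_continuous.
  rewrite -[X in _ --> X]addr0; apply: cvgD; first exact: cvg_cst.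
  exact: cvg_harmonic.
apply: (ler_cvg_to (f := fun i => \sum_r rho r i) _ gcvg).
  by apply: cvg_big => [|r _]; [exact: add_continuous|exact: rhoD].
apply: nearW => i; have h0 : 0 <= i.+1%:R^-1 :> R by rewrite invr_ge0.
apply: (@le_trans _ _ (i.+1%:R * (((1 + i.+1%:R^-1) ^+ m - 1) * vol n s))).
  apply: le_trans (ler_sum _ (fun r _ => rho_le r i)) _; rewrite -mulr_sumr ler_wpM2l//.
  exact: (sum_vol_increments s_gt0 s_fin).
by rewrite subrX1 addrAC subrr add0r -!mulrA mulVKf.
Qed.

Hypothesis vol_gt0 : 0 < vol n s.

Lemma convol_Delta_le x v :
  polytope n2 s x -> convol (Delta_w n s) (meanzero_ffun n2 x) v <= m%:R / (n ^ 2)%:R.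
Proof.
move=> xP; have [w0 wle] := weights_ge0_sum_le.
have v0 : vol n s != 0 by rewrite gt_eqF.
rewrite -(ler_pM2l (_ : 0 < 2 * vol n s)) ?mulr_gt0// convol_Delta_w//.
apply: (@le_trans _ _ (2 * \sum_r s 0 r * weights n s 0 r)); last first.
  by rewrite -mulrA ler_pM2l// (mulrC (vol n s)).
have fE : meanzero_ffun n2 x = meanzero_row n2 x :> (torus n ->
  R) by apply/funext => u; rewrite ffunE.
rewrite fE; case: v => p q; rewrite /hess_op.
have -> : \sum_r s 0 r * weights n s 0 r =
    s 0 0 * weights n s 0 0 + s 0 1 * weights n s 0 1 + s 0 2 * weights n s 0 2.
  rewrite !big_ord_recl big_ord0 addr0 addrA.
  by congr (_ + _ + _); congr (s 0 _ * weights n s 0 _); exact/val_inj.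
have h0 u : D0 (meanzero_row n2 x) u <= s 0 0 := xP (u, 0).
have h1 u : D1 (meanzero_row n2 x) u <= s 0 1 := xP (u, 1).
have h2 u : D2 (meanzero_row n2 x) u <= s 0 2 := xP (u, 2).
have le_two (a b c w : R) : 0 <= w -> a <= c -> b <= c -> w * (a + b) <= 2 * (c * w).
  by move=> ? ? ?; rewrite mulrA [leRHS]mulrC ler_wpM2l// mulr_natl mulr2n lerD.
rewrite [leRHS]mulrDr [X in _ <= X + _]mulrDr.
by apply: lerD; [apply: lerD|]; exact: le_two.
Qed.

(** The reflection v |-> - v exchanges the two rhombi of each family that enter
    the Hessian operator at 0. *)
Lemma Delta_w_even v : Delta_w n s (- v) = Delta_w n s v.
Proof.
rewrite !ffunE; congr (_ / _).
case: v => p q; rewrite /hess_op /D0 /D1 /D2 /= !ffunE.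
have sub2 (z : 'Z_n) : z - 1 + 2 = z + 1 by rewrite -[2]/(1 + 1) addrA subrK.
have oppB (z : 'Z_n) : - z - 1 = - (z + 1) by rewrite opprD.
have oppD (z : 'Z_n) : - z + 1 = - (z - 1) by rewrite opprB addrC.
have opp0 (a b : 'Z_n) : ((- a, - b) == 0 :> torus n) = ((a, b) == 0 :> torus n).
  exact: (oppr_eq0 (a, b)).
rewrite !sub2 !subrK !oppB !oppD !opp0; ring.
Qed.

(** * Comparison with the simplex *)

(** The map x |-> x B + c sends the coordinates of f to the differences between
    c = m / N and the values of the convolution off one vertex; the bound at the
    omitted vertex becomes the bound on their sum. *)
Lemma vol_absdet_le : vol n s * absdet_Delta_w n s <= n%:R * expR m%:R.
Proof.
rewrite /absdet_Delta_w (eigenvalue_prod_convol n2 Delta_w_even).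
set M := convol_mx _ _.
have n0 : 0 < n%:R :> R by rewrite ltr0n ltnW.
have [->|M0] := eqVneq (\det M) 0.
  by rewrite normr0 mulr0 mulr_ge0 ?expR_ge0// ltW.
pose c := m%:R / (n ^ 2)%:R : R.
pose B := - (M *m tilt).
have dB : `|\det B| = `|\det M| / n%:R.
  rewrite /B -scaleN1r detZ !normrM normrX normrN1 expr1n mul1r det_mulmx normrM.
  by rewrite det_tilt// normrN normfV [`|n%:R|]gtr0_norm.
have dB0 : \det B != 0.
  by rewrite -normr_gt0 dB divr_gt0// normr_gt0.
have sub : polytope n2 s `<=` [set x | @simplex R m m%:R (x *m B + const_mx c)].
  move=> x xP /=.
  have coordE j : (x *m B + const_mx c) 0 j =
      c - convol (Delta_w n s) (meanzero_ffun n2 x) (vertex n2 (lift ord0 j)).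
    rewrite (convol_meanzero_row n2) ffunE /meanzero_row extendS mxE [const_mx _ _
      _]mxE addrC.
    by rewrite mulmxN mulmxA [in LHS]mxE.
  split=> [j|]; first by rewrite coordE subr_ge0 convol_Delta_le.
  under eq_bigr do rewrite coordE.
  have := convol_Delta_le (vertex n2 ord0) xP.
  have := convol_meanzero (Delta_w n s) (meanzero_ffun_meanzero n2 x).
  rewrite meanzeroE (sum_vertex n2) => /eqP/eqP; rewrite addr_eq0 => /eqP ->.
  rewrite sumrB sumr_const card_ord -/c => h.
  have -> : m%:R = c *+ m + c.
    rewrite -mulrSr -[RHS]mulr_natr /c -[in X in _ * X](addn1 m) subnK ?expn_gt0
      ?(ltnW n2)//.
    by rewrite mulfVK// pnatr_eq0 expn_eq0 -leqn0 leqNgt (ltnW n2).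
  by rewrite lerD2l.
have mS : row_measurable [set x | @simplex R m m%:R (x *m B + const_mx c)].
  by apply: row_measurable_lin; exact: row_measurable_simplex.
have := row_volume_le (row_measurable_polytope n2 s) mS sub.
rewrite row_volume_affine//; last exact: row_measurable_simplex.
rewrite lee_pdivlMl ?normr_gt0// => /le_trans/(_ (row_volume_simplex m m%:R)).
rewrite -(fineK (_ : row_volume (polytope n2 s) \is a fin_num)); last first.
  by rewrite ge0_fin_numE//; exact: measure_ge0.
rewrite -volE -EFinM lee_fin dB mulrAC ler_pdivrMr// mulrC [leRHS]mulrC.
exact.
Qed.

End weights.

(** An infinite measure is turned into volume 0 by fine, and then the left-hand
    side vanishes. *)
Lemma volume_bound (R : realType) (n : nat) (s : 'rV[R]_3) : (2 <= n)%N ->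
  (forall r, 0 < s 0 r) -> absdet_Delta_w n s * vol n s <= n%:R * expR (n ^ 2 - 1)%:R.
Proof.
move=> n2 s0.
have pos : 0 <= n%:R * expR (n ^ 2 - 1)%:R :> R by rewrite mulr_ge0// expR_ge0.
have [v0|v0] := leP (vol n s) 0.
  by apply: le_trans pos; rewrite mulr_ge0_le0 //; exact: normr_ge0.
rewrite mulrC; apply: (vol_absdet_le (n2 := n2)) => //.
by move: v0; rewrite (volE n2); case: (row_volume _) => [r _|/=|/=];
  rewrite ?ltry ?ltxx.
Qed.

Theorem lemma4p1 (R : realType) (s : 'rV[R]_3) (hs : forall r, 0 < s 0 r) :
  exists2 eps : R^nat, eps n @[n --> \oo] --> (0 : R) &
    forall n, (2 <= n)%N ->
      let m := (n ^ 2 - 1)%N in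
      absdet_Delta_w n s `^ (m%:R^-1) * vol n s `^ (m%:R^-1)
        <= expR 1 + eps n.
Proof.
exists (fun n => expR 1 * (expR n.+1%:R^-1 - 1)).
  have exp_cvg : expR (n.+1%:R^-1) @[n --> \oo] --> (expR 0 : R).
    by apply: (continuous_cvg _ (@continuous_expR R 0)); exact: cvg_harmonic.
  rewrite expR0 in exp_cvg.
  rewrite -(mulr0 (expR 1)) -(subrr (1 : R)); apply: cvgMr.
  by apply: cvgB => //; exact: cvg_cst.
move=> n n2; cbv zeta; set m := (n ^ 2 - 1)%N.
have n_gt0 : 0 < n%:R :> R by rewrite ltr0n ltnW.
have mE : m%:R = (n%:R - 1) * n.+1%:R :> R.
  by rewrite natrB ?expn_gt0 ?(ltnW n2)// natrX -[n.+1%:R]natr1; ring.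
have m0 : 0 < m%:R :> R by rewrite mE mulr_gt0// subr_gt0 ltr1n.
have vol_ge0 : 0 <= vol n s by apply: fine_ge0; rewrite -lebesgue_tuple_measureE;
  exact: measure_ge0.
rewrite -powRM//; last exact: normr_ge0.
apply: (@le_trans _ _ ((n%:R * expR m%:R) `^ m%:R^-1)).
  rewrite ge0_ler_powR ?nnegrE ?invr_ge0//.
  - by rewrite mulr_ge0// normr_ge0.
  - exact: volume_bound.
(* n^(1/m) = exp(ln n / m), where ln n <= n - 1 and m = (n - 1)(n + 1). *)
rewrite powRM ?expR_ge0// -expRM mulfV ?gt_eqF// mulrBr mulr1 addrC subrK mulrC.
rewrite ler_pM2l ?expR_gt0// /powR gt_eqF// ler_expR.
rewrite mulrC ler_pdivrMr// mE mulrCA mulVf ?mulr1// ?pnatr_eq0//.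
by have := expR_ge1Dx (ln (n%:R : R)); rewrite lnK ?posrE//; lra.
Qed.
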